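(* Let $(E,d)$ be a Polish space with Borel $\sigma$-field $\mathcal{E}$, and let $(P_t)_{t\in\mathbb{R}_+}$ be a Markov semigroup on $E$ with transition function $\{P_t(x,A)\}$. Suppose there exists $x_0\in E$ such that for every $M>0$ there exist a function $R\colon\mathbb{R}_+\to\mathbb{R}_+$ with $\lim_{t\to\infty}R(t)=0$ and an $\varepsilon>0$ (both possibly depending on $M$) such that for any $x,y\in B_M(x_0)$ and any $t\ge 0$ there exist $E$-valued random variables $Y^{x,y}_t$ and $Z^{x,y}_t$ on a common probability space with the following properties: 1. $\mathrm{Law}(Y^{x,y}_t)=P_t(y,\cdot)$ and $d_{TV}\big(\mathrm{Law}(Z^{x,y}_t),P_t(x,\cdot)\big)\le 1-\varepsilon$; 2. $\mathsf{E}\,d(Y^{x,y}_t,Z^{x,y}_t)\le R(t)$. Then $(P_t)_{t\in\mathbb{R}_+}$ is locally weak irreducible.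
   Context: Notation: $\mathbb{R}_+=[0,\infty)$; $B_R(x)=\{z\in E\colon d(z,x)<R\}$ is the open ball. $P_t\delta_x$ denotes the probability measure $P_t(x,\cdot)$. The total variation distance is $d_{TV}(\mu,\nu)=\sup_{A\in\mathcal{E}}|\mu(A)-\nu(A)|$. For Borel probability measures $\mu,\nu$ on $E$, $\mathscr{C}(\mu,\nu)$ is the set of all couplings, i.e. probability measures on $E\times E$ with marginals $\mu$ and $\nu$. Local weak irreducibility: $(P_t)_{t\in\mathbb{R}_+}$ is locally weak irreducible if there exists $x_0\in E$ such that for any $R>0$ and $\varepsilon>0$ there exists $T=T(R,\varepsilon)>0$ such that for any $t\ge T$, $$\inf_{x,y\in B_R(x_0)}\ \sup_{\Gamma\in\mathscr{C}(P_t\delta_x,P_t\delta_y)}\Gamma\big(\{(x',y')\in E\times E\colon d(x',y')\le\varepsilon\}\big)>0.$$ *)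

(* Defs.v *)
From HB Require Import structures.
From mathcomp Require Import all_boot all_order all_algebra.
From mathcomp Require Import all_classical all_reals all_analysis.

Set Implicit Arguments.
Unset Strict Implicit.
Unset Printing Implicit Defensive.

Import Order.TTheory GRing.Theory Num.Theory.
Import numFieldNormedType.Exports.

Local Open Scope classical_set_scope.
Local Open Scope ring_scope.

#[short(type="completeMetricType")]
HB.structure Definition CompleteMetric (R : numDomainType) :=
  {T of Metric R T & Complete T}.

Definition separable (T : topologicalType) : Prop :=
  exists2 D : set T, countable D & dense D.

(* A copy of E carrying its Borel sigma-algebra. On borel E * borel E the
   measurable structure is the product sigma-algebra, which for a separable
   metric space E is the Borel sigma-algebra of the product space. *)
Notation borel E := (g_sigma_algebraType (@open E)).

Definition tv_dist d (T : measurableType d) (R : realType)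
    (mu nu : {measure set T -> \bar R}) : \bar R :=
  ereal_sup [set (`|mu A - nu A|)%E | A in measurable].

Definition couplings d (T : measurableType d) (R : realType)
    (mu nu : {measure set T -> \bar R}) : set (probability (T * T)%type R) :=
  [set G | (forall A : set T, measurable A -> G (A `*` setT) = mu A) /\
           (forall B : set T, measurable B -> G (setT `*` B) = nu B)].

(* The time set [0, +oo) is encoded by total families indexed by R whose values
   at negative times are irrelevant. *)
Definition markov_semigroup d (T : measurableType d) (R : realType)
    (P : R -> R.-pker T ~> T) : Prop :=
  (forall (x : T) (A : set T), measurable A -> P 0 x A = \d_x A) /\
  (forall s t : R, 0 <= s -> 0 <= t -> forall (x : T) (A : set T),
    measurable A -> P (s + t) x A = (\int[P s x]_y P t y A)%E).

Definition locally_weak_irreducible (R : realType) (E : completeMetricType R)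
    (P : R -> R.-pker (borel E) ~> (borel E)) : Prop :=
  exists x0 : E, forall r eps : R, 0 < r -> 0 < eps ->
    exists2 T : R, 0 < T & forall t : R, T <= t ->
      (0 < ereal_inf
        [set ereal_sup
          [set (G : probability (borel E * borel E)%type R)
                 [set z : E * E | (mdist z.1 z.2 <= eps)%R]
          | G in couplings (P t x) (P t y)]
        | x in ball x0 r & y in ball x0 r])%E.

(* Main.v *)
Require Import Defs.
From HB Require Import structures.
From mathcomp Require Import all_boot all_order all_algebra.
From mathcomp Require Import all_classical all_reals all_analysis.
From mathcomp Require Import measurable_realfun lra.

Set Implicit Arguments.
Unset Strict Implicit.
Unset Printing Implicit Defensive.

Import Order.TTheory GRing.Theory Num.Theory.
Import numFieldNormedType.Exports.

Local Open Scope classical_set_scope.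
Local Open Scope ring_scope.

(** The hypothesis provides, for [x] and [y] in a ball, a pair [(Z, Y)] whose
    components are close in mean: [Y] has the law [P t y], but the law [zeta]
    of [Z] only overlaps with [mu = P t x] by a mass at least [eps].  A coupling
    of [P t x] and [P t y] is obtained by keeping the law of [(Z, Y)] only where
    [zeta] charges no more than [mu], and completing the rest arbitrarily.

    With [c = eps / 2], a Hahn decomposition of the charge [mu - c zeta] gives a
    set [H] on which [c zeta <= mu] and off which [mu <= c zeta]
    ([split_above_multiple]).  The measure [c Law(Z, Y)] restricted to
    [H * E] then has marginals dominated by [mu] and [P t y], so it extends to
    a coupling by adding a product measure that carries the missing mass
    ([coupling_completion]).  Since [mu (~ H) <= c zeta (~ H) <= c] and the
    total variation distance is at most [1 - eps], the set [H] has
    [zeta]-measure at least [1 - c - (1 - eps) = eps / 2].  The coupling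
    therefore gives the set of [e]-close pairs a mass at least
    [c (eps / 2 - Q (mdist Z Y > e))] ([coupling_of_approximate_pair]), and by
    Markov's inequality this is at least [eps ^ 2 / 8] as soon as
    [rho t < e * eps / 4], which holds for all large [t], uniformly in [x] and
    [y].

    Using the multiple [c zeta] rather than the minimum of [zeta] and [mu]
    keeps the retained part a plain restriction of the law of [(Z, Y)]: neither
    densities nor conditional laws (for a gluing of couplings) are involved.
    Separability makes the distance measurable for the product sigma-algebra
    ([measurable_mdist]). *)

(** * Couplings with prescribed marginals *)

Section probability_of_measure.
Context d (T : measurableType d) (R : realType).
Variables (mu : {measure set T -> \bar R}) (mu1 : mu setT = 1%E).

Definition probability_of_measure of mu setT = 1%E : set T -> \bar R := mu.

HB.instance Definition _ := Measure.on (probability_of_measure mu1).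
HB.instance Definition _ :=
  Measure_isProbability.Build _ _ _ (probability_of_measure mu1) mu1.

End probability_of_measure.

(** The residual measures [a] and [b] have the same mass [m = 1 - g setT], so
    [g + (a \x b) / m] has marginals [mu] and [nu]. *)
Lemma coupling_completion d (T : measurableType d) (R : realType)
    (mu nu : probability T R) (g : {measure set (T * T) -> \bar R})
    (a b : {measure set T -> \bar R}) :
  (g setT < 1)%E ->
  (forall A, measurable A -> g (A `*` setT) + a A = mu A)%E ->
  (forall B, measurable B -> g (setT `*` B) + b B = nu B)%E ->
  exists2 G, couplings mu nu G & forall D, (g D <= G D)%E.
Proof.
move=> g1 ga gb.
have gfin : g setT \is a fin_num by rewrite ge0_fin_numE// (lt_trans g1)// ltry.
set m := (1 - fine (g setT))%R.
have m0 : 0 < m.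
  by rewrite subr_gt0 -lte_fin fineK.
have resT (rho : probability T R) (r : {measure set T -> \bar R}) :
    (g setT + r setT = rho setT)%E -> r setT = m%:E.
  rewrite probability_setT => E.
  have rE : (r setT = 1 - g setT)%E by rewrite -E addeAC subee// add0e.
  by rewrite rE EFinB fineK.
have aT : a setT = m%:E by apply: (resT mu); rewrite -ga// setXTT.
have bT : b setT = m%:E by apply: (resT nu); rewrite -gb// setXTT.
have normE (rho : probability T R) (r : {measure set T -> \bar R}) A :
    r setT = m%:E -> (m%:E * mnormalize r rho A = r A)%E.
  move=> rT; rewrite /mnormalize rT eqe gt_eqF//= muleCA -EFinM divff ?mule1//.
  by rewrite gt_eqF.
(* Since a and b have mass m, neither 0 nor infinite, the normalizations never
   take their default values mu and nu. *)
pose prodab : probability (T * T)%type R :=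
  (mnormalize a mu \x mnormalize b nu)%E.
have prodE A B : measurable A -> measurable B ->
    (prodab (A `*` B) = mnormalize a mu A * mnormalize b nu B)%E.
  by move=> mA mB; exact: product_measure1E.
pose h := measure_add g (mscale (NngNum (ltW m0)) prodab).
have hE D : h D = (g D + m%:E * prodab D)%E by rewrite /h measure_addE.
have hl A : measurable A -> h (A `*` setT) = mu A.
  move=> mA; rewrite hE prodE//.
  by rewrite muleA normE// [X in (_ * X)%E]probability_setT mule1 ga.
have hr B : measurable B -> h (setT `*` B) = nu B.
  move=> mB; rewrite hE prodE//.
  by rewrite [X in (_ * (X * _))%E]probability_setT mul1e normE// gb.
have h1 : h setT = 1%E by rewrite -setXTT hl// probability_setT.
exists (probability_of_measure h1) => [//|D].
rewrite [leRHS](hE D) leeDl//.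
by rewrite mule_ge0// lee_fin ltW.
Qed.

(** The part [c zeta] of [mu] on [H] is split off from [mu], leaving the
    measure [a]; outside of [H] the probability [mu] has little mass when [c]
    is small.  [H] is the positive set of [mu - c zeta] and [a] is the positive
    part of this charge, plus the restriction of [mu] to the complement of
    [H]. *)
Lemma split_above_multiple d (T : measurableType d) (R : realType)
    (mu zeta : probability T R) (c : R) : 0 < c ->
  exists H (a : {measure set T -> \bar R}), [/\ measurable H,
    forall A, measurable A -> (c%:E * zeta (A `&` H) + a A = mu A)%E &
    (mu (~` H) <= c%:E * zeta (~` H))%E].
Proof.
move=> c0.
pose nu := cadd (charge_of_finite_measure mu)
                (cscale (- c) (charge_of_finite_measure zeta)).
have nuE A : nu A = (mu A - c%:E * zeta A)%E.
  by rewrite -[nu A]/(mu A + (- c)%:E * zeta A)%E EFinN mulNe.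
have [H [N nuHN]] := Hahn_decomposition nu.
have [[mH posH] [mN negN] HN HN0] := nuHN.
have NE : N = ~` H.
  apply/seteqP; split=> [x Nx Hx|x nHx].
    by have : (H `&` N) x by []; rewrite HN0.
  by have : [set: T] x by []; rewrite -HN => -[].
pose a := measure_add (jordan_pos nuHN) (mrestr mu mN).
have aE A : a A = (jordan_pos nuHN A + mu (A `&` N))%E.
  by rewrite /a measure_addE.
exists H, a; split => //.
- move=> A mA; have mAH : measurable (A `&` H) by exact: measurableI.
  have jE : jordan_pos nuHN A = (mu (A `&` H) - c%:E * zeta (A `&` H))%E.
    by rewrite jordan_posE cjordan_posE /crestr0 mem_set//=; exact: nuE.
  rewrite [X in (_ + X)%E](aE A) jE NE addeA [X in (X + _)%E]addeC subeK.
    by rewrite -setDE addeC -measureDI.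
  by rewrite fin_numM// fin_num_measure.
- have : (mu N - c%:E * zeta N <= 0)%E by rewrite -nuE; exact: negN.
  by rewrite sube_le0 NE// fin_numM// fin_num_measure.
Qed.

Lemma scaled_image_of_restriction d (T : measurableType d) (R : realType)
    d' (Omega : measurableType d') (Q : {measure set Omega -> \bar R})
    (f : Omega -> T) (c : R) (W : set Omega) :
  measurable_fun setT f -> 0 <= c -> measurable W ->
  exists g : {measure set T -> \bar R},
    forall B, (g B = c%:E * Q (f @^-1` B `&` W))%E.
Proof.
move=> mf c0 mW.
by unshelve eexists (mscale (NngNum c0) (pushforward (mrestr Q mW) f)).
Qed.

(** If [Z] is a copy of [mu] only up to a total variation error [1 - eps], then
    [mu] and the law of [Y] still have a coupling that inherits from the pair
    [(Z, Y)] a positive mass on [D], provided that [(Z, Y)] misses [D] with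
    probability less than [eps / 2]. *)
Lemma coupling_of_approximate_pair d (T : measurableType d) (R : realType)
    d' (Omega : measurableType d') (Q : probability Omega R)
    (Y Z : {RV Q >-> T}) (mu : probability T R) (eps : R) (D : set (T * T)) :
  0 < eps -> (tv_dist (distribution Q Z) mu <= (1 - eps)%:E)%E ->
  measurable D ->
  exists2 G, couplings mu (distribution Q Y) G &
    ((eps / 2)%:E * ((eps / 2)%:E - Q [set w | ~ D (Z w, Y w)]) <= G D)%E.
Proof.
move=> eps0 tv mD.
have tvA A : measurable A ->
    (`|distribution Q Z A - mu A| <= (1 - eps)%:E)%E.
  by move=> mA; apply: le_trans tv; apply: ereal_sup_ubound; exists A.
(* The empty set witnesses that the total variation distance is nonnegative. *)
have eps1 : eps <= 1.
  by have := tvA _ measurable0; rewrite !measure0 subee// abse0 lee_fin subr_ge0.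
pose c := eps / 2.
have c0 : 0 < c by rewrite divr_gt0.
have c1 : 0 < 1 - c by rewrite /c; lra.
have [H [a [mH aH muH]]] := split_above_multiple mu (distribution Q Z) c0.
have mZY : measurable_fun setT (fun w => (Z w, Y w)).
  by apply: measurable_fun_pair; exact: measurable_funPT.
pose ZH := Z @^-1` H.
have mZH : measurable ZH by exact: measurable_funPTI.
have mZHC : measurable (~` ZH) by exact: measurableC.
(* g is the retained part c Law(Z, Y) on H * T; its second marginal is at most
   c Law(Y), and b' is what is left of Law(Y). *)
have [g gE] := scaled_image_of_restriction Q mZY (ltW c0) mZH.
have [b bE] := scaled_image_of_restriction Q (measurable_funPT Y) (ltW c0) mZHC.
pose b' := measure_add (mscale (NngNum (ltW c1)) (distribution Q Y)) b.
have b'E B : b' B = ((1 - c)%:E * Q (Y @^-1` B) + b B)%E.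
  by rewrite /b' measure_addE.
have QZH : ((eps / 2)%:E <= Q ZH)%E.
  have mHC := measurableC mH.
  have : (`|Q (~` ZH) - mu (~` H)| <= (1 - eps)%:E)%E by exact: tvA.
  have : (mu (~` H) <= c%:E * Q (~` ZH))%E by [].
  have -> : Q ZH = (1 - Q (~` ZH))%E by rewrite -probability_setC// setCK.
  have := probability_le1 Q mZHC.
  rewrite -(fineK (fin_num_measure Q _ mZHC)) -(fineK (fin_num_measure mu _ mHC)).
  rewrite -!EFinM -!EFinB !lee_fin ler_norml => z1 uz /andP[_ zu].
  move: z1 uz zu; set z := fine _; set u := fine _ => z1 uz zu.
  have : c * z <= c by rewrite ler_piMr// ltW.
  rewrite /c in uz *; lra.
have mD' : measurable ((fun w => (Z w, Y w)) @^-1` D).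
  by rewrite -[_ @^-1` _]setTI; exact: mZY.
have mDC : measurable [set w | ~ D (Z w, Y w)] by exact: measurableC.
have [G cG gG] : exists2 G, couplings mu (distribution Q Y) G &
    forall D, (g D <= G D)%E.
  apply: (@coupling_completion _ _ _ _ _ g a b').
  - rewrite gE preimage_setT setTI; apply: (@le_lt_trans _ _ c%:E).
      by rewrite -[leRHS]mule1 lee_pmul2l// ?probability_le1.
    by rewrite lte_fin; lra.
  - move=> A mA; rewrite gE -aH//; congr (_ * Q _ + _)%E.
    by apply/seteqP; split=> [w [[]]|w []].
  - move=> B mB; rewrite [X in (_ + X)%E]b'E gE bE.
    rewrite -[RHS]/(Q (Y @^-1` B)).
    have -> : (fun w => (Z w, Y w)) @^-1` (setT `*` B) = Y @^-1` B.
      by apply/seteqP; split=> [w []|w].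
    rewrite addeCA -ge0_muleDr//.
    rewrite -setDE [X in (c%:E * X)%E]addeC -measureDI//; last first.
      exact: measurable_funPTI.
    rewrite -ge0_muleDl ?lee_fin ?ltW//.
    by rewrite -EFinD subrK mul1e.
exists G => //; apply: le_trans (gG D); rewrite gE lee_pmul2l//.
rewrite leeBlDr ?fin_num_measure//; apply: le_trans QZH _.
apply: le_trans (measureU2 _ _ mDC); last exact: measurableI.
apply: le_measure; rewrite ?inE//.
  by apply: measurableU; [exact: measurableI|exact: mDC].
by move=> w ZHw; case: (pselect (D (Z w, Y w))) => ?; [left|right].
Qed.

(** * The distance as a random variable *)

Lemma markov_ge0 (R : realType) d (Omega : measurableType d)
    (Q : probability Omega R) (f : Omega -> R) (e : R) :
  measurable_fun setT f -> (forall w, 0 <= f w) -> 0 < e ->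
  (e%:E * Q [set w | (e < f w)%R] <= 'E_Q[f])%E.
Proof.
move=> mf f0 e0.
pose X : {RV Q >-> R} := mfun_Sub (mem_set mf).
have := @markov _ _ _ Q X id e e0 (@measurable_id _ _ _) (fun r => id)
  (fun x y _ _ => id).
rewrite (_ : (_ \o X) = f); last first.
  by apply/funext => w /=; rewrite ger0_norm// f0.
apply: le_trans; rewrite lee_pmul2l//; apply: le_measure; rewrite ?inE.
- rewrite -[X in measurable X]setTI -preimage_itvoy.
  by apply: (mf measurableT); exact: measurable_itv.
- have -> : [set w | (e%:E <= `|(X w)%:E|)%E] = setT `&` [set w | e <= f w].
    by rewrite setTI; apply/seteqP; split => w /=; rewrite lee_fin ger0_norm ?f0.
  by rewrite -preimage_itvcy; apply: (mf measurableT); exact: measurable_itv.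
- by move=> w /= /ltW; rewrite lee_fin ger0_norm ?f0.
Qed.

(** The set of pairs at distance more than [r] is a countable union of
    measurable rectangles: [r < mdist x y] if and only if, for some [k], some
    point [s] of a countable dense set is within [1 / (k + 1)] of [x] and
    farther than [r + 1 / (k + 1)] from [y]. *)
Lemma measurable_mdist (R : realType) (E : completeMetricType R) :
  separable E ->
  measurable_fun setT (fun z : borel E * borel E => mdist (z.1 : E) (z.2 : E)).
Proof.
move=> [S cS dS].
have oball (s : E) e : open (ball s e).
  rewrite openE => x /=.
  rewrite ballEmdist/= => xe; apply/nbhs_ballP; exists (e - mdist s x) => /=.
    by rewrite subr_gt0.
  move=> y; rewrite !ballEmdist/= ltrBrDl => xy.
  by rewrite (le_lt_trans (metric_triangle _ x _)).
have mball (s : E) e : measurable (ball s e : set (borel E)).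
  by apply: sub_sigma_algebra; exact: oball.
have mfar (s : E) e : measurable ([set y | e < mdist s y] : set (borel E)).
  apply: sub_sigma_algebra; rewrite /= openE => x /= xe.
  apply/nbhs_ballP; exists (mdist s x - e) => /=.
    by rewrite subr_gt0.
  move=> y; rewrite ballEmdist/= => xy.
  have := metric_triangle s y x; rewrite (metric_sym y x); lra.
apply: (measurability _ (RGenOInfty.measurableE R)) => _ [_ [r ->] <-].
rewrite setTI.
have -> : (fun z : borel E * borel E => mdist (z.1 : E) (z.2 : E))
      @^-1` `]r, +oo[
    = \bigcup_(s in S) \bigcup_k
        (ball s k.+1%:R^-1 `*` [set y | r + k.+1%:R^-1 < mdist s y]).
  apply/seteqP; split=> [[x y]|[x y] [s Ss [k _ /= []]]]; last first.
    rewrite ballEmdist /= in_itv/= andbT.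
    have lin (a b c k' : R) : a <= b + c -> b < k' -> r + k' < a -> r < c by lra.
    exact/lin/metric_triangle.
  rewrite /= in_itv/= andbT => rxy.
  have rxy2 : 0 < (mdist (x : E) (y : E) - r) / 2.
    by rewrite divr_gt0// subr_gt0.
  have [k _ /(_ k (leqnn k))/= kxy] := near_infty_natSinv_lt (PosNum rxy2).
  have k0 : 0 < k.+1%:R^-1 :> R by rewrite invr_gt0.
  have [s [/= sx Ss]] : (ball (x : E) k.+1%:R^-1 `&` S) !=set0.
    apply: dS; first by exists x; exact: ballxx.
    exact: oball.
  exists s => //; exists k => //; split; first exact: ball_sym.
  have lin (a b c k' : R) :
    a <= b + c -> b < k' -> k' < (a - r) / 2 -> r + k' < c by lra.
  move: sx; rewrite ballEmdist/= => sx.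
  exact: lin (metric_triangle _ _ _) sx kxy.
rewrite bigcup_set_type; apply: countable_bigcupT_measurable => [|s].
  by rewrite (eq_countable (card_setT _)).
by apply: bigcupT_measurable => k; exact: measurableX.
Qed.

(** * Local weak irreducibility *)

Theorem theorem2p7 (R : realType) (E : completeMetricType R)
    (sepE : separable E)
    (P : R -> R.-pker (borel E) ~> (borel E)) (semiP : markov_semigroup P)
    (gcoupl : exists x0 : E, forall M : R, 0 < M ->
      exists (rho : R -> R) (eps : R),
        [/\ forall t : R, 0 <= t -> 0 <= rho t,
            rho t @[t --> +oo] --> 0,
            0 < eps &
            forall x y : E, ball x0 M x -> ball x0 M y ->
            forall t : R, 0 <= t ->
            exists (d : measure_display) (Omega : measurableType d)
                   (Q : probability Omega R) (Y Z : {RV Q >-> borel E}),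
              [/\ forall A : set (borel E), measurable A ->
                    distribution Q Y A = P t y A,
                  (tv_dist (distribution Q Z) (P t x) <= (1 - eps)%:E)%E &
                  ('E_Q[fun w => mdist (Y w : E) (Z w : E)]
                    <= (rho t)%:E)%E]]) :
  locally_weak_irreducible P.
Proof.
have [x0 gc] := gcoupl; exists x0 => r e r0 e0.
have [rho [eps [_ rho0 eps0 cpl]]] := gc r r0.
(* Markov's inequality turns a mean distance below eps / 4 * e into a
   probability below eps / 4 of being more than e apart. *)
pose del := eps / 4 * e.
have del0 : 0 < del by rewrite mulr_gt0// divr_gt0.
have [T [_ rhoT]] : \forall t \near +oo, rho t < del.
  exact: cvgr_lt rho0 _ del0.
exists (Num.max 1 (T + 1)); first by rewrite lt_max ltr01.
move=> t; rewrite ge_max => /andP[t1 tT].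
have rhot : rho t < del by apply: rhoT; lra.
have t0 : 0 <= t by rewrite (le_trans _ t1).
apply: (@lt_le_trans _ _ (eps / 2 * (eps / 4))%:E).
  by rewrite lte_fin mulr_gt0// divr_gt0.
apply: le_ereal_inf_tmp => _ [x xr [y yr <-]].
have [d0 [Om [Q [Y [Z [lawY tvZ EYZ]]]]]] := cpl x y xr yr t t0.
pose D : set (borel E * borel E) := [set z | mdist (z.1 : E) (z.2 : E) <= e].
have mdE := measurable_mdist sepE.
have mD : measurable D.
  rewrite -[D]setTI /D -preimage_itvNyc.
  by apply: (mdE measurableT); exact: measurable_itv.
have Px1 : P t x setT = 1%E by exact: prob_kernel.
pose mu : probability (borel E) R := probability_of_measure Px1.
have [G [Gl Gr] GD] :=
  @coupling_of_approximate_pair _ _ _ _ _ Q Y Z mu eps D eps0 tvZ mD.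
have GP : couplings (P t x) (P t y) G.
  by split=> // B mB; rewrite Gr//; exact: lawY.
apply: (@le_trans _ _ (G D)); last by apply: ereal_sup_ubound; exists G.
apply: le_trans GD.
rewrite EFinM lee_pmul2l//; last by rewrite lte_fin divr_gt0.
have mYZ : measurable_fun setT (fun w => (Y w, Z w)).
  by apply: measurable_fun_pair; exact: measurable_funPT.
have := markov_ge0 Q (measurableT_comp mdE mYZ)
  (fun w => mdist_ge0 (Y w : E) (Z w : E)) e0.
move=> /le_trans /(_ EYZ).
have -> : [set w | e < mdist (Y w : E) (Z w : E)] = [set w | ~ D (Z w, Y w)].
  apply/seteqP; split => w; rewrite /D /= metric_sym.
    by rewrite ltNge => /negP.
  by move=> /negP; rewrite -ltNge.
have mDC : measurable [set w | ~ D (Z w, Y w)].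
  have mZY : measurable_fun setT (fun w => (Z w, Y w)).
    by apply: measurable_fun_pair; exact: measurable_funPT.
  rewrite -[X in measurable X](setTI ((fun w => (Z w, Y w)) @^-1` (~` D))).
  by apply: (mZY measurableT); exact: measurableC.
rewrite -(fineK (fin_num_measure Q _ mDC)) -EFinM -EFinB !lee_fin.
set q := fine _ => eq.
have : e * q < e * (eps / 4).
  by apply: le_lt_trans eq _; rewrite [ltRHS]mulrC.
rewrite ltr_pM2l//; lra.
Qed.
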